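(* Let $A \in \mathcal M_d(\mathbb R)$, let $\tau$ be a continuous delay function such that $\inf_{s \in [0, t]} \tau(s) > 0$ for every $t \geq 0$, let $h$ be its associated largest delay function, and let $x_0 \in \mathsf C_0$. Then there exists a unique continuous solution $x \in C(\lvert -h(0), +\infty), \mathbb R^d)$ of $$x(t) = A x(t - \tau(t)), \qquad t \geq 0,$$ with initial condition $x_0$. In addition, $x_t \in \mathsf C_t$ for every $t \in \mathbb R_+$.
   Context: $\mathbb R_+ = [0, +\infty)$, $\mathbb R_+^\ast = (0, +\infty)$; $\mathcal M_d(\mathbb R)$ is the set of real $d \times d$ matrices, $d$ a positive integer. For $a \leq b$ in $\mathbb R \cup \{\pm\infty\}$, $\lvert a, b]$ denotes $[a, b]$ if $a > -\infty$ and $(a, b]$ if $a = -\infty$; $\lvert a, b)$ is defined similarly. A \emph{delay function} is any function $\tau\colon \mathbb R_+ \to \mathbb R_+^\ast$. Its \emph{largest delay function} is $h\colon \mathbb R_+ \to \mathbb R_+^\ast \cup \{+\infty\}$, $h(t) = t - \inf_{s \in [t, +\infty)} (s - \tau(s))$. A \emph{continuous solution} is a continuous function $x\colon \lvert -h(0), +\infty) \to \mathbb R^d$ such that $x(t) = A x(t - \tau(t))$ for every $t \in \mathbb R_+$; its \emph{initial condition} is its restriction to $\lvert -h(0), 0]$. For $t \in \mathbb R_+$, $\mathsf C_t = \{y \in C(\lvert -h(t), 0], \mathbb R^d) \mid y(0) = A y(-\tau(t))\}$, and $x_t\colon \lvert -h(t), 0] \to \mathbb R^d$ is defined by $x_t(s)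 = x(t + s)$. *)

(* Defs.v *)
From HB Require Import structures.
From mathcomp Require Import all_boot all_order all_algebra.
From mathcomp Require Import all_classical all_reals all_analysis.
Set Implicit Arguments.
Unset Strict Implicit.
Unset Printing Implicit Defensive.
Import Order.TTheory GRing.Theory Num.Theory.
Import numFieldNormedType.Exports.
Local Open Scope classical_set_scope.
Local Open Scope ring_scope.

(* The real points of |a, b] and of |a, b): a finite left endpoint belongs to
   the interval, and the left endpoint -oo imposes no constraint.             *)
Definition lint_cc (R : realType) (a b : \bar R) : set R :=
  [set s | (a <= s%:E)%E /\ (s%:E <= b)%E].

Definition lint_co (R : realType) (a b : \bar R) : set R :=
  [set s | (a <= s%:E)%E /\ (s%:E < b)%E].

(* Functions defined on a subset of R are total functions of which only the
   values on that subset matter: R_+ for a delay function, |-h(0), +oo) for a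
   solution, |-h(t), 0] for an element of C_t.                                *)
Definition delay_function (R : realType) (tau : R -> R) : Prop :=
  forall t, 0 <= t -> 0 < tau t.

Definition largest_delay (R : realType) (tau : R -> R) (t : R) : \bar R :=
  (t%:E - ereal_inf [set (s - tau s)%:E | s in `[t, +oo[])%E.

Definition solution_domain (R : realType) (tau : R -> R) : set R :=
  lint_co (- largest_delay tau 0)%E +oo%E.

Definition history_domain (R : realType) (tau : R -> R) (t : R) : set R :=
  lint_cc (- largest_delay tau t)%E 0%E.

Definition continuous_solution (R : realType) (d : nat) (A : 'M[R]_d)
    (tau : R -> R) (x : R -> 'cV[R]_d) : Prop :=
  {within solution_domain tau, continuous x} /\
  forall t, 0 <= t -> x t = A *m x (t - tau t).

Definition has_initial_condition (R : realType) (d : nat) (tau : R -> R)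
    (x x0 : R -> 'cV[R]_d) : Prop :=
  forall s, history_domain tau 0 s -> x s = x0 s.

Definition phase_space (R : realType) (d : nat) (A : 'M[R]_d)
    (tau : R -> R) (t : R) : set (R -> 'cV[R]_d) :=
  [set y | {within history_domain tau t, continuous y} /\
           y 0 = A *m y (- tau t)].

Definition history (R : realType) (d : nat) (x : R -> 'cV[R]_d) (t : R) :
    R -> 'cV[R]_d :=
  fun s => x (t + s).

(* Main.v *)
Require Import Defs.
From HB Require Import structures.
From mathcomp Require Import all_boot all_order all_algebra.
From mathcomp Require Import all_classical all_reals all_analysis.
From mathcomp Require Import lra.
Set Implicit Arguments.
Unset Strict Implicit.
Unset Printing Implicit Defensive.
Import Order.TTheory GRing.Theory Num.Theory.
Import numFieldNormedType.Exports.
Local Open Scope classical_set_scope.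
Local Open Scope ring_scope.

(* Method of steps.  On [0, T] the delay is bounded below by some c > 0, so an
   argument t <= T is pushed into the history domain after at most T / c
   applications of t |-> t - tau t.  Hence the iterates of
   y |-> (x0 on the history domain, A y(. - tau) on R_+), all of which are
   continuous because x0 satisfies the compatibility condition at 0, become
   stationary on bounded sets; their eventual value is the solution.          *)

(** [A *m v] is a finite combination of the fixed columns of [A] whose coefficients are the
    coordinates of [v], and these are continuous. *)
Lemma mulmx_continuous (R : realType) (m n : nat) (A : 'M[R]_(m, n)) :
  continuous (fun v : 'cV[R]_n => A *m v).
Proof.
have -> : (fun v : 'cV[R]_n => A *m v) =
          (fun v : 'cV[R]_n => \sum_j (v j 0 *: col j A)).
  apply/funext => v; apply/matrixP => i k; rewrite !mxE summxE.
  by apply: eq_bigr => j _; rewrite !mxE ord1 mulrC.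
apply: continuous_big => [|j _ v]; first exact: add_continuous.
apply: (@cvgZr_tmp _ _ _ (nbhs v) _ (fun w : 'cV[R]_n => w j 0)).
exact: coord_continuous.
Qed.

Lemma within_continuous_comp_sub (U V W : topologicalType) (A : set U)
    (B : set V) (f : U -> V) (g : V -> W) :
  {within A, continuous f} -> {within B, continuous g} ->
  {homo f : x / A x >-> B x} -> {within A, continuous (g \o f)}.
Proof.
move=> /subspace_continuousP cf /subspace_continuousP cg fAB.
apply/subspace_continuousP => x Ax.
move=> P gP.
have fgP : \forall y \near x, A y -> B (f y) -> P (g (f y)) :=
  cf _ Ax _ (cg _ (fAB _ Ax) P gP).
suff : \forall y \near x, A y -> P (g (f y)) by [].
by apply: filterS fgP => y gfP Ay; apply: gfP => //; exact: fAB.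
Qed.

(** Continuity is local, so [g] may change with the point. This passes continuity from the iterates
    to the solution, which near each point equals one of them. *)
Lemma within_continuous_near_eq (U V : topologicalType) (A : set U)
    (f : U -> V) :
  (forall p, A p -> exists g : U -> V, [/\ {within A, continuous g},
     g p = f p & \forall q \near p, A q -> g q = f q]) ->
  {within A, continuous f}.
Proof.
move=> fg; apply/subspace_continuousP => p Ap.
have [g [/subspace_continuousP /(_ p Ap) cg gp gf]] := fg p Ap.
have {}cg : g x @[x --> within A (nbhs p)] --> f p by rewrite -gp.
apply: cvg_trans cg; exact: near_eq_cvg.
Qed.

Lemma within_continuous_eq (U V : topologicalType) (A : set U)
    (f g : U -> V) :
  (forall x, A x -> g x = f x) -> {within A, continuous g} ->
  {within A, continuous f}.
Proof.
move=> gf cg; apply: within_continuous_near_eq => p Ap; exists g.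
by split; [| exact: gf | exact: nearW].
Qed.

Lemma solution_domainE (R : realType) (tau : R -> R) (s : R) :
  solution_domain tau s <->
  (ereal_inf [set (r - tau r)%:E | r in `[0%R, +oo[] <= s%:E)%E.
Proof.
rewrite /solution_domain /lint_co /largest_delay /= sub0e oppeK ltry.
by split=> [[]|].
Qed.

Lemma solution_domain_delayed (R : realType) (tau : R -> R) (t : R) :
  0 <= t -> solution_domain tau (t - tau t).
Proof.
move=> t0; apply/solution_domainE; apply: ereal_inf_lbound.
by exists t => //=; rewrite in_itv /= t0.
Qed.

Lemma solution_domain_ge0 (R : realType) (tau : R -> R) (t : R) :
  delay_function tau -> 0 <= t -> solution_domain tau t.
Proof.
move=> htau t0; apply/solution_domainE.
apply: (@le_trans _ _ (0 - tau 0)%:E).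
  exact/solution_domainE/solution_domain_delayed.
by rewrite lee_fin; have := htau 0 (lexx 0); lra.
Qed.

Lemma history_domain0E (R : realType) (tau : R -> R) (s : R) :
  history_domain tau 0 s <-> solution_domain tau s /\ s <= 0.
Proof.
rewrite solution_domainE /history_domain /lint_cc /largest_delay /=.
by rewrite sub0e oppeK lee_fin.
Qed.

(** In absolute time the window at [t] starts at the infimum of [r - tau r] over [r >= t], and
    shrinking the index set can only raise an infimum. *)
Lemma history_domain_shift (R : realType) (tau : R -> R) (t s : R) :
  0 <= t -> history_domain tau t s -> solution_domain tau (t + s).
Proof.
move=> t0; rewrite /history_domain /lint_cc /largest_delay /= => -[ts _].
apply/solution_domainE.
apply: (@le_trans _ _ (ereal_inf [set (r - tau r)%:E | r in `[t, +oo[])).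
  apply: ereal_inf_le_tmp => _ [r /= + <-]; rewrite in_itv /= andbT => tr.
  by exists r => //=; rewrite in_itv /= andbT (le_trans t0 tr).
move: ts; case: (ereal_inf _) => [r| |] //=; last by move=> _; exact: leNye.
by rewrite !lee_fin; lra.
Qed.

(** Both constraints are preimages of closed rays of the extended line, whether or not the delay is
    finite. Gluing at 0 relies on this. *)
Lemma closed_history_domain (R : realType) (tau : R -> R) (t : R) :
  closed (history_domain tau t).
Proof.
have -> : history_domain tau t =
    EFin @^-1` [set x | (- largest_delay tau t <= x)%E] `&`
    EFin @^-1` [set x | (x <= 0%:E)%E] by [].
have cE : continuous (@EFin R).
  by move=> x; apply: cvg_EFin; [exact: nearW | exact: cvg_id].
by apply: closedI; apply: preimage_closed => [x _|];
  [exact: cE | exact: closed_ereal_le_ereal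
  |exact: cE | exact: closed_ereal_ge_ereal].
Qed.

Lemma delay_lower_bound (R : realType) (tau : R -> R) :
  delay_function tau ->
  (forall t, 0 <= t -> 0 < inf [set tau s | s in `[0, t]]) ->
  forall T, exists2 c, 0 < c & forall t, 0 <= t -> t <= T -> c <= tau t.
Proof.
(* The maximum with 0 makes [tau_inf] applicable when [T < 0], where the bound is vacuous. *)
move=> htau tau_inf T; exists (inf [set tau s | s in `[0, Num.max 0 T]]).
  by apply: tau_inf; rewrite le_max lexx.
move=> t t0 tT; apply: ge_inf.
  by exists 0 => _ [s /= + <-]; rewrite in_itv /= => /andP[/htau/ltW].
by exists t => //=; rewrite in_itv /= t0 le_max tT orbT.
Qed.

(** Each delay moves a time in []0, T]] left by at least [c], so [n] delays bring [t <= n * c] to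
    nonpositive time. The base case covers every [n] because fewer delays may be enough. *)
Lemma steps_ind (R : realType) (tau : R -> R) (c T : R)
    (P : nat -> R -> Prop) :
  delay_function tau ->
  (forall t, 0 <= t -> t <= T -> c <= tau t) ->
  (forall n t, solution_domain tau t -> t <= 0 -> P n t) ->
  (forall n t, 0 < t -> P n (t - tau t) -> P n.+1 t) ->
  forall n t, solution_domain tau t -> t <= T -> t <= n%:R * c -> P n t.
Proof.
move=> htau ctau P0 PS; elim=> [|n IH] t Dt tT tn.
  by apply: P0 => //; rewrite mul0r in tn.
have [t0|t0] := leP t 0; first exact: P0.
have ct := ctau t (ltW t0) tT; have tau0 := htau t (ltW t0).
apply: PS => //; apply: IH.
- exact/solution_domain_delayed/ltW.
- by lra.
- by move: tn; rewrite -natr1 mulrDl mul1r; lra.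
Qed.

Lemma delay_equation_unique (R : realType) (d : nat) (A : 'M[R]_d)
    (tau : R -> R) (y z : R -> 'cV[R]_d) :
  delay_function tau ->
  (forall t, 0 <= t -> 0 < inf [set tau s | s in `[0, t]]) ->
  (forall t, 0 <= t -> y t = A *m y (t - tau t)) ->
  (forall t, 0 <= t -> z t = A *m z (t - tau t)) ->
  (forall s, history_domain tau 0 s -> y s = z s) ->
  forall t, solution_domain tau t -> y t = z t.
Proof.
move=> htau tau_inf ey ez yz t Dt.
have [c c0 ctau] := delay_lower_bound htau tau_inf t.
(* The chosen [n] is a natural number above [t / c], hence enough steps for [t]. *)
apply: (steps_ind (P := fun _ t => y t = z t) htau ctau _ _
  (n := (Num.trunc (t / c)).+1)) => //.
- by move=> _ s Ds s0; apply: yz; apply/history_domain0E.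
- by move=> _ s /ltW s0 yzs; rewrite (ey s s0) (ez s s0) yzs.
- by rewrite -ler_pdivrMr // ltW // truncnS_gt.
Qed.

(** Level 0 freezes [x0] at its value at 0, a continuous start for the iteration. *)
Fixpoint step_iterate (R : realType) (d : nat) (A : 'M[R]_d) (tau : R -> R)
    (x0 : R -> 'cV[R]_d) (n : nat) (t : R) : 'cV[R]_d :=
  if t <= 0 then x0 t
  else if n is m.+1 then A *m step_iterate A tau x0 m (t - tau t) else x0 0.

Lemma step_iterate_le0 (R : realType) (d : nat) (A : 'M[R]_d) (tau : R -> R)
    (x0 : R -> 'cV[R]_d) (n : nat) (t : R) :
  t <= 0 -> step_iterate A tau x0 n t = x0 t.
Proof. by case: n => [|n] /= ->. Qed.

(** Only [t = 0] needs an argument: there the iterate returns [x0 0], and the compatibility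
    condition in [phase_space] turns it into [A *m x0 (- tau 0)]. *)
Lemma step_iterateS (R : realType) (d : nat) (A : 'M[R]_d) (tau : R -> R)
    (x0 : R -> 'cV[R]_d) (n : nat) (t : R) :
  delay_function tau -> phase_space A tau 0 x0 -> 0 <= t ->
  step_iterate A tau x0 n.+1 t = A *m step_iterate A tau x0 n (t - tau t).
Proof.
move=> htau [_ x00]; rewrite le_eqVlt => /predU1P[<-|/lt_geF /= -> //].
have tau0 := htau 0 (lexx 0).
by rewrite sub0r !step_iterate_le0 // oppr_le0 ltW.
Qed.

(** The domain is a union of two closed pieces meeting at 0, so continuity is checked on each. The
    induction runs over the whole domain because [t - tau t] may fall in either piece. *)
Lemma step_iterate_continuous (R : realType) (d : nat) (A : 'M[R]_d)
    (tau : R -> R) (x0 : R -> 'cV[R]_d) (n : nat) :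
  delay_function tau -> {within `[0, +oo[, continuous tau} ->
  phase_space A tau 0 x0 ->
  {within solution_domain tau, continuous (step_iterate A tau x0 n)}.
Proof.
move=> htau ctau hx0; have [cx0 _] := hx0.
have -> : solution_domain tau = history_domain tau 0 `|` `[0, +oo[.
  apply/seteqP; split => t /=; rewrite in_itv /= andbT.
    by move=> Dt; have [|/ltW] := leP t 0; [left; exact/history_domain0E|right].
  by move=> [/history_domain0E[]//|]; exact: solution_domain_ge0.
have glue (f : R -> 'cV[R]_d) :
    (forall t, t <= 0 -> f t = x0 t) -> {within `[0, +oo[, continuous f} ->
    {within history_domain tau 0 `|` `[0, +oo[, continuous f}.
  move=> fx0; apply: withinU_continuous.
  - exact: closed_history_domain.
  - exact: interval_closed.
  - apply: within_continuous_eq cx0 => s /history_domain0E[_ s0].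
    by rewrite fx0.
have dom0 t : `[0, +oo[%classic t -> 0 <= t.
  by rewrite /= in_itv /= andbT.
elim: n => [|n IH].
  apply: glue => [t t0|]; first exact: step_iterate_le0.
  apply: (@within_continuous_eq _ _ _ _ (cst (x0 0))).
    move=> t /dom0; rewrite le_eqVlt => /predU1P[<-|/lt_geF /= -> //].
    by rewrite step_iterate_le0.
  exact/continuous_subspaceT/cst_continuous.
apply: glue => [t t0|]; first exact: step_iterate_le0.
apply: (@within_continuous_eq _ _ _ _
   ((mulmx A \o step_iterate A tau x0 n) \o (fun t => t - tau t))).
  by move=> t /dom0 t0; rewrite step_iterateS.
apply: within_continuous_comp_sub.
- apply: within_continuousB => //.
  by apply: continuous_subspaceT => t; exact: cvg_id.
- apply: within_continuous_comp IH => v _; exact: mulmx_continuous.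
- move=> t /dom0 t0; have := solution_domain_delayed tau t0.
  have [t1|/ltW t1] := leP (t - tau t) 0; first by left; exact/history_domain0E.
  by right; rewrite /= in_itv /= t1.
Qed.

(** A single [N] serves all times up to [T], since the step bound depends on [T] alone; continuity
    of the limit rests on this uniformity. *)
Lemma step_iterate_stationary (R : realType) (d : nat) (A : 'M[R]_d)
    (tau : R -> R) (x0 : R -> 'cV[R]_d) :
  delay_function tau ->
  (forall t, 0 <= t -> 0 < inf [set tau s | s in `[0, t]]) ->
  phase_space A tau 0 x0 ->
  forall T, exists N, forall t, solution_domain tau t -> t <= T ->
    forall n, (N <= n)%N ->
      step_iterate A tau x0 n t = step_iterate A tau x0 N t.
Proof.
move=> htau tau_inf hx0 T.
have [c c0 ctau] := delay_lower_bound htau tau_inf T.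
exists (Num.trunc (T / c)).+1 => t Dt tT.
apply: (steps_ind (P := fun m t => forall n, (m <= n)%N ->
  step_iterate A tau x0 n t = step_iterate A tau x0 m t) htau ctau) => //.
- by move=> m s _ s0 n _; rewrite !step_iterate_le0.
- move=> m s s0 IH [//|n] mn.
  by rewrite !step_iterateS // ?ltW // IH.
- by apply: le_trans tT _; rewrite -ler_pdivrMr // ltW // truncnS_gt.
Qed.

Theorem theorem4p17 (R : realType) (d : nat) (hd : (0 < d)%N) (A : 'M[R]_d)
  (tau : R -> R) (htau : delay_function tau)
  (tau_cont : {within `[0, +oo[, continuous tau})
  (tau_inf : forall t, 0 <= t -> 0 < inf [set tau s | s in `[0, t]])
  (x0 : R -> 'cV[R]_d) (hx0 : phase_space A tau 0 x0) :
  exists x : R -> 'cV[R]_d,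
    [/\ continuous_solution A tau x,
        has_initial_condition tau x x0,
        (forall y : R -> 'cV[R]_d,
           continuous_solution A tau y -> has_initial_condition tau y x0 ->
           forall t, solution_domain tau t -> y t = x t)
      & forall t, 0 <= t -> phase_space A tau t (history x t)].
Proof.
have [N stat] := choice (step_iterate_stationary htau tau_inf hx0).
pose x t := step_iterate A tau x0 (N t) t.
have xE T t n : solution_domain tau t -> t <= T -> (N T <= n)%N ->
    step_iterate A tau x0 n t = x t.
  (* The levels [N T] and [N t] are compared through their maximum, where both stationarity
     statements apply. *)
  move=> Dt tT Tn; rewrite (stat T t Dt tT n Tn) /x.
  rewrite -(stat T t Dt tT (maxn (N T) (N t)) (leq_maxl _ _)).
  by rewrite (stat t t Dt (lexx t)) // leq_maxr.
have x_eq t : 0 <= t -> x t = A *m x (t - tau t).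
  move=> t0; have Dt := solution_domain_ge0 htau t0.
  (* One level above [N t], so that unfolding one step leaves level [N t], still sufficient at the
     earlier time [t - tau t]. *)
  rewrite -(xE t t (N t).+1) // step_iterateS // (xE t) //.
    exact: solution_domain_delayed.
  by have := htau t t0; rewrite gerBl => /ltW.
have x_init : has_initial_condition tau x x0.
  by move=> s /history_domain0E[_ s0]; rewrite /x step_iterate_le0.
have x_cont : {within solution_domain tau, continuous x}.
  apply: within_continuous_near_eq => p Dp.
  (* The margin 1 makes this one level valid on a neighbourhood of [p], not only up to [p]. *)
  exists (step_iterate A tau x0 (N (p + 1))); split.
  - exact: step_iterate_continuous.
  - by apply: (xE (p + 1)) => //; rewrite lerDl.
  - near=> q => Dq; apply: (xE (p + 1)) => //.
    by apply: ltW; near: q; apply: lt_nbhsl; rewrite ltrDl.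
exists x; split=> //.
- move=> y [_ y_eq] y_init; apply: delay_equation_unique y_eq x_eq _ => //.
  by move=> s Ds; rewrite y_init // x_init.
- move=> t t0; split; last by rewrite /history addr0 x_eq.
  apply: (within_continuous_comp_sub (f := fun s => t + s)) x_cont _.
    apply: continuous_subspaceT => s.
    by apply: cvgD; [exact: cvg_cst | exact: cvg_id].
  by move=> s; exact: history_domain_shift.
Unshelve. all: by end_near.
Qed.
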